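(* For all $n\geq 2$ and $k\ge 0$, the number $b_{n,k}(132,321)$ of permutations $\pi\in\mathfrak{S}_n(132,321)$ with $\mathrm{bdes}(\pi)=k$ is $$b_{n,k}(132,321)=\begin{cases} 2, & \text{if }k=0,\\ \binom{n}{2}-1, & \text{if }k=1,\\ 0, & \text{otherwise.}\end{cases}$$
   Context: $\mathfrak{S}_n$ is the set of permutations $\pi=\pi_1\pi_2\cdots\pi_n$ of $[n]=\{1,\dots,n\}$ in one-line notation. $\mathfrak{S}_n(132,321)$ is the set of $\pi\in\mathfrak{S}_n$ having no length-three subsequence with the same relative order as $132$ or as $321$. An index $k\in[n-1]$ is a big descent of $\pi\in\mathfrak{S}_n$ if $\pi_k>\pi_{k+1}+1$; $\mathrm{bdes}(\pi)$ is the number of big descents of $\pi$. *)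

(* Defs.v *)
From mathcomp Require Import all_boot all_fingroup.

Set Implicit Arguments.
Unset Strict Implicit.
Unset Printing Implicit Defensive.

(* A permutation of [n] is an element of 'S_n = {perm 'I_n}; positions and
   values are thus numbered 0, ..., n-1 rather than 1, ..., n.  Pattern
   containment and big descents only involve order and differences of
   values, so they are unaffected by this shift. *)

(* A pattern is given in one-line notation, e.g. [:: 1; 3; 2].  The function f
   gives the positions of the subsequence.  Comparing the entries at positions
   i < j suffices, since neither pi nor a pattern has repeated values. *)
Definition contains (n : nat) (pi : 'S_n) (sigma : seq nat) : bool :=
  [exists f : {ffun 'I_(size sigma) -> 'I_n},
    [forall i : 'I_(size sigma), forall j : 'I_(size sigma),
      (i < j) ==>
        (f i < f j) &&
        ((pi (f i) < pi (f j)) == (nth 0 sigma i < nth 0 sigma j))]].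

Definition avoids (n : nat) (pi : 'S_n) (sigma : seq nat) : bool :=
  ~~ contains pi sigma.

(* The witness l is the position following k, so the last position is never
   a big descent. *)
Definition big_descent (n : nat) (pi : 'S_n) (k : 'I_n) : bool :=
  [exists l : 'I_n, (l == k.+1 :> nat) && (pi k > pi l + 1)].

Definition bdes (n : nat) (pi : 'S_n) : nat :=
  #|[set k : 'I_n | big_descent pi k]|.

Definition b_132_321 (n k : nat) : nat :=
  #|[set pi : 'S_n | [&& avoids pi [:: 1; 3; 2],
                         avoids pi [:: 3; 2; 1]
                       & bdes pi == k]]|.

(* Main.v *)
Require Import Defs.
From mathcomp Require Import all_boot all_fingroup.
From mathcomp Require Import zify.

(** Let [pi] avoid 132 and 321 and let [r] be its first value. The values above
    [r] appear in increasing order (no 132), so do the values below [r] (no 321),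
    and no larger value stands between two smaller ones (no 132). Hence the
    one-line notation of [pi] is that of the identity with two adjacent blocks
    swapped, the first of which is initial. Apart from the identity there is one
    such permutation for each pair [x < y], where [x] is the largest value below
    [r] and [y] its position; its only descent goes from the value [y] to the
    value [0], and is big unless [y = 1]. *)

(** * Patterns of length three *)

Lemma contains3P (n : nat) (pi : 'S_n) (a b c : nat) :
  reflect (exists i j k : 'I_n,
             [/\ i < j, j < k, (pi i < pi j) = (a < b),
                 (pi i < pi k) = (a < c) & (pi j < pi k) = (b < c)])
          (contains pi [:: a; b; c]).
Proof.
apply: (iffP existsP) => [[f /forallP H]|[i [j [k [ij jk eij eik ejk]]]]].
  have {}H (u v : 'I_3) : u < v -> f u < f v /\
      (pi (f u) < pi (f v)) = (nth 0 [:: a; b; c] u < nth 0 [:: a; b; c] v).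
    by move=> uv; have /forallP/(_ v)/implyP/(_ uv)/andP[-> /eqP] := H u.
  pose o0 : 'I_3 := @Ordinal 3 0 isT; pose o1 : 'I_3 := @Ordinal 3 1 isT.
  pose o2 : 'I_3 := @Ordinal 3 2 isT.
  have [? ?] := H o0 o1 isT; have [? ?] := H o0 o2 isT.
  have [? ?] := H o1 o2 isT.
  by exists (f o0), (f o1), (f o2).
(* The default [i] of [nth] is never reached, since [t < 3]. *)
exists [ffun t : 'I_3 => nth i [:: i; j; k] t].
apply/forallP => -[[|[|[|u]]] ltu] //; apply/forallP => -[[|[|[|v]]] ltv] //=;
  by rewrite !ffunE /= ?eij ?eik ?ejk ?eqxx ?andbT ?(ltn_trans ij jk).
Qed.

Lemma perm_ltn_neq (n : nat) (pi : 'S_n) (i j : 'I_n) :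
  i < j -> pi i <> pi j :> nat.
Proof. by move=> ij /val_inj/perm_inj E; rewrite E ltnn in ij. Qed.

Arguments perm_ltn_neq {n} pi {i j}.

Lemma avoids132P (n : nat) (pi : 'S_n) :
  reflect (forall i j k : 'I_n, i < j -> j < k -> ~~ (pi i < pi k < pi j))
          (avoids pi [:: 1; 3; 2]).
Proof.
apply: (iffP idP) => [/contains3P H i j k ij jk|H].
  by apply/negP => lts; apply: H; exists i, j, k; split; lia.
apply/contains3P => -[i [j [k [ij jk eij eik ejk]]]].
have := perm_ltn_neq pi jk; have := H _ _ _ ij jk; lia.
Qed.

Lemma avoids321P (n : nat) (pi : 'S_n) :
  reflect (forall i j k : 'I_n, i < j -> j < k -> ~~ (pi k < pi j < pi i))
          (avoids pi [:: 3; 2; 1]).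
Proof.
apply: (iffP idP) => [/contains3P H i j k ij jk|H].
  by apply/negP => lts; apply: H; exists i, j, k; split; lia.
apply/contains3P => -[i [j [k [ij jk eij eik ejk]]]].
have := perm_ltn_neq pi jk; have := perm_ltn_neq pi ij.
by have := H _ _ _ ij jk; lia.
Qed.

(** A value equals the number of positions that carry smaller values, so the relative order of the
    entries determines the permutation. *)
Lemma perm_ltn_inj (n : nat) (pi sigma : 'S_n) :
  (forall i j, (pi i < pi j) = (sigma i < sigma j)) -> pi = sigma.
Proof.
have rankE (tau : 'S_n) i : #|[set j | tau j < tau i]| = tau i.
  have -> : [set j | tau j < tau i] = tau @^-1: [set v : 'I_n | v < tau i].
    by apply/setP => j; rewrite !inE.
  rewrite card_preimset; last exact: perm_inj.
  rewrite -sum1dep_card (big_ord_narrow (ltnW (ltn_ord (tau i)))) /=.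
  by rewrite sum1_card card_ord.
move=> eq_lt; apply/permP => i; apply/val_inj => /=.
by rewrite -(rankE pi) -(rankE sigma); apply: eq_card => j; rewrite !inE eq_lt.
Qed.

Ltac lia_ifs := repeat (case: ifP => ?); lia.

(** * Swaps of two adjacent blocks of the identity *)

Section BlockSwap.

Variables (n : nat) (x y : 'I_n).

(* The identity when [y <= x], since then [y - x = 0]. *)
Definition block_swap_nat (i : nat) : nat :=
  if i < y - x then i + x.+1
  else if i < y - x + x.+1 then i - (y - x) else i.

Lemma block_swap_subproof (i : 'I_n) : block_swap_nat i < n.
Proof.
have := ltn_ord i; have := ltn_ord x; have := ltn_ord y.
by rewrite /block_swap_nat; lia_ifs.
Qed.

Lemma block_swap_inj : injective (fun i => Ordinal (block_swap_subproof i)).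
Proof.
move=> i j [] E; apply/val_inj => /=; move: E; rewrite /block_swap_nat; lia_ifs.
Qed.

Definition block_swap : 'S_n := perm block_swap_inj.

Lemma block_swapE (i : 'I_n) : block_swap i = block_swap_nat i :> nat.
Proof. by rewrite permE. Qed.

Lemma block_swap_avoids132 : avoids block_swap [:: 1; 3; 2].
Proof.
by apply/avoids132P => i j k ij jk; rewrite !block_swapE /block_swap_nat;
  lia_ifs.
Qed.

Lemma block_swap_avoids321 : avoids block_swap [:: 3; 2; 1].
Proof.
by apply/avoids321P => i j k ij jk; rewrite !block_swapE /block_swap_nat;
  lia_ifs.
Qed.

Lemma big_descent_block_swap (i : 'I_n) :
  big_descent block_swap i = [&& x < y, 1 < y & i.+1 == y - x].
Proof.
apply/existsP/idP => [[l]|H].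
  by rewrite !block_swapE /block_swap_nat; lia_ifs.
have lt_in : i.+1 < n by have := ltn_ord y; lia.
by exists (Ordinal lt_in); rewrite !block_swapE /block_swap_nat /=; lia_ifs.
Qed.

Lemma bdes_block_swap : bdes block_swap = (x < y) && (1 < y).
Proof.
rewrite /bdes; have [/andP[xy y1]|H] := boolP ((x < y) && (1 < y)).
  have lt_n : (y - x).-1 < n by have := ltn_ord y; lia.
  transitivity #|[set Ordinal lt_n]|; last exact: cards1.
  apply: eq_card => i.
  by rewrite !inE big_descent_block_swap -val_eqE /=; lia.
apply/eqP; rewrite cards_eq0; apply/eqP/setP => i.
by rewrite !inE big_descent_block_swap; lia.
Qed.

End BlockSwap.

Arguments block_swap_nat {n}.
Arguments block_swap {n}.

Lemma block_swap_eq1 (n : nat) (x y : 'I_n) : y <= x -> block_swap x y = 1%g.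
Proof.
by move=> yx; apply/permP => i; apply/val_inj;
  rewrite /= block_swapE perm1 /block_swap_nat; lia_ifs.
Qed.

Lemma block_swap_inj2 (n : nat) (x y x' y' : 'I_n) :
  x < y -> x' < y' -> block_swap x y = block_swap x' y' -> (x, y) = (x', y').
Proof.
move=> xy xy' E.
have H (i : nat) : i < n -> block_swap_nat x y i = block_swap_nat x' y' i.
  by move=> lt_in; have := block_swapE n x y (Ordinal lt_in);
    rewrite E block_swapE.
(* The value at position 0 is [x.+1]. *)
have xx' : x = x' :> nat.
  have := H 0 (leq_ltn_trans (leq0n x) (ltn_ord x)).
  by rewrite /block_swap_nat; lia_ifs.
have yn := ltn_ord y; have yn' := ltn_ord y'.
(* The value 0 stands at position [y - x] in one swap and at [y' - x'] in the other. *)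
have /H : y - x < n by lia.
have /H : y' - x' < n by lia.
rewrite /block_swap_nat => E1 E2; congr pair; apply/val_inj => //=.
by move: E1 E2; lia_ifs.
Qed.

(** * Every avoider is a block swap *)

Section Avoider.

Variables (n : nat) (pi : 'S_n.+1).
Hypotheses (av132 : avoids pi [:: 1; 3; 2]) (av321 : avoids pi [:: 3; 2; 1]).

(** Otherwise [pi ord0], [pi i], [pi j] form a 321. *)
Lemma avoider_below_first (i j : 'I_n.+1) :
  pi j < pi ord0 -> i < j -> pi i < pi j \/ pi ord0 <= pi i.
Proof.
move=> j0 ij; case: (posnP i) => [i0|i_gt0].
  by right; rewrite (_ : i = ord0) //; apply/val_inj.
have /avoids321P/(_ ord0 i j i_gt0 ij) := av321.
have := perm_ltn_neq pi ij; lia.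
Qed.

(** Otherwise [pi ord0], [pi i], [pi j] form a 132. *)
Lemma avoider_above_first (i j : 'I_n.+1) :
  pi ord0 <= pi i -> pi ord0 <= pi j -> i < j -> pi i < pi j.
Proof.
move=> i0 j0 ij.
have := perm_ltn_neq pi ij; case: (posnP i) => [iz|i_gt0].
  by have -> : i = ord0 by [apply/val_inj]; lia.
have := perm_ltn_neq pi (ltn_trans i_gt0 ij : @ord0 n < j).
by have /avoids132P/(_ ord0 i j i_gt0 ij) := av132; lia.
Qed.

(** By induction on [t]: the values below the first one fill consecutive positions in increasing
    order, starting where 0 stands. *)
Lemma avoider_small_position (t : nat) (i : 'I_n.+1) :
  t < pi ord0 -> pi i = t :> nat -> i = (pi^-1)%g ord0 + t :> nat.
Proof.
elim: t i => [|t IHt] i t0 it.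
  by rewrite addn0; congr (nat_of_ord _); apply: (@perm_inj _ pi);
    rewrite permKV; apply/val_inj.
have lt_tn : t < n.+1 by have := ltn_ord (pi i); lia.
pose p := (pi^-1)%g (Ordinal lt_tn).
have pt : pi p = t :> nat by rewrite permKV.
have := IHt p (ltnW t0) pt; rewrite addnS => <-.
have lt_pi : p < i.
  have : p != i by apply/eqP => E; move: it; rewrite -E pt; lia.
  rewrite -val_eqE /= => ne; case: (ltngtP p i) ne => // lt_ip _.
  have pt0 : pi p < pi ord0 by rewrite pt ltnW.
  by have [|] := avoider_below_first _ _ pt0 lt_ip; lia.
(* Suppose a position [q] follows [p] before [i]. A value at [q] below the first one would lie
   strictly between [t] and [t.+1]; any other completes a 132 at [p], [q], [i]. *)
case: (ltngtP p.+1 i) => [gap||//]; last by lia.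
have lt_q : p.+1 < n.+1 by have := ltn_ord i; lia.
pose q := Ordinal lt_q.
have /avoids132P/(_ p q i (ltnSn p) gap) := av132.
have i0 : pi i < pi ord0 by rewrite it.
have := perm_ltn_neq pi (gap : q < i).
have := perm_ltn_neq pi (ltnSn p : p < q).
case: (avoider_below_first _ _ i0 (gap : q < i)) => [qi|]; last by lia.
by case: (avoider_below_first _ _ (ltn_trans qi i0) (ltnSn p : p < q)); lia.
Qed.

Lemma avoider_block_swap : exists x y : 'I_n.+1, pi = block_swap x y.
Proof.
case: (posnP (pi ord0)) => [r0|r_gt0].
  (* No value is below 0, so [pi] is increasing, hence the identity. *)
  exists ord0, ord0; apply: perm_ltn_inj => i j.
  rewrite block_swap_eq1 // !perm1.
  case: (ltngtP i j) => [ij|ji|/val_inj ->]; last by rewrite ltnn.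
    by rewrite avoider_above_first ?r0.
  by apply/negbTE; rewrite -leqNgt ltnW // avoider_above_first ?r0.
(* The position of 0 is the length of the first block. *)
pose a := (pi^-1)%g ord0 : 'I_n.+1.
have a_gt0 : 0 < a.
  rewrite lt0n; apply/eqP => a0; move: r_gt0.
  by rewrite (_ : ord0 = a) ?permKV //; apply/val_inj; rewrite /= a0.
have lt_xn : (pi ord0).-1 < n.+1 by have := ltn_ord (pi ord0); lia.
pose x := Ordinal lt_xn; pose y := (pi^-1)%g x : 'I_n.+1.
have yE : y = a + x :> nat.
  by apply: avoider_small_position; rewrite ?permKV //= ; lia.
have smallE i : pi i < pi ord0 -> i = a + pi i :> nat.
  by move=> H; apply: avoider_small_position.
(* The value [i - a] is at most [x], so it stands at position [i]. *)
have smallP (i : 'I_n.+1) : a <= i <= y -> pi i < pi ord0.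
  move=> /andP[ai iy].
  have lt_n : i - a < n.+1 by have := ltn_ord i; lia.
  pose j := (pi^-1)%g (Ordinal lt_n).
  have jE : pi j = i - a :> nat by rewrite permKV.
  have lt_j : pi j < pi ord0 by rewrite jE; move: yE; rewrite /x /=; lia.
  suff <- : j = i by [].
  by apply/val_inj; rewrite /= (smallE j lt_j) jE; lia.
have x_val : x.+1 = pi ord0 :> nat by rewrite /x /=; lia.
(* The positions from [a] to [y] are exactly those of the values below the first one, so all
   comparisons of entries are known. *)
exists x, y; apply: perm_ltn_inj => i j.
rewrite !block_swapE /block_swap_nat.
have := smallE i; have := smallE j; have := smallP i; have := smallP j.
move: (avoider_above_first i j) (avoider_above_first j i) => ? ? ? ? ? ?.
case: (ltngtP i j) => [ij|ji|/val_inj ->]; last by rewrite !ltnn.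
all: by case: (ltnP (pi i) (pi ord0)) => ?;
  case: (ltnP (pi j) (pi ord0)) => ?; lia_ifs.
Qed.

End Avoider.

(** * Counting *)

Lemma card_ltn_pairs (n : nat) :
  #|[set p : 'I_n * 'I_n | p.1 < p.2]| = 'C(n, 2).
Proof.
rewrite -sum1dep_card.
rewrite -(pair_big_dep xpredT (fun i j : 'I_n => i < j) (fun _ _ => 1)) /=.
(* With the larger entry [j] fixed first, there are [j] choices for the smaller one. *)
rewrite (exchange_big_dep xpredT) //= -bin2_sum big_mkord.
apply: eq_bigr => j _.
by rewrite (big_ord_narrow (ltnW (ltn_ord j))) /= sum1_card card_ord.
Qed.

Theorem proposition3p13 (n k : nat) (hn : 2 <= n) :
  b_132_321 n k =
    match k with
    | 0 => 2
    | 1 => 'C(n, 2) - 1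
    | _ => 0
    end.
Proof.
case: n hn => [//|n] hn; rewrite /b_132_321.
set A := [set pi | _].
have AP (pi : 'S_n.+1) :
    reflect (exists x y, pi = block_swap x y /\ (x < y) && (1 < y) = k :> nat)
            (pi \in A).
  rewrite inE; apply: (iffP and3P) => [[a132 a321 /eqP bk]|[x [y [-> bk]]]].
    have [x [y E]] := avoider_block_swap _ _ a132 a321.
    by exists x, y; rewrite -bdes_block_swap -E.
  by rewrite block_swap_avoids132 block_swap_avoids321 bdes_block_swap bk.
pose o1 : 'I_n.+1 := Ordinal hn.
case: k A AP => [|[|k]] A AP.
(* Without a big descent, either [y <= x], giving the identity, or [x < y <= 1], forcing [x = 0] and
   [y = 1]. *)
- have -> : A = [set 1%g; block_swap ord0 o1].
    apply/setP => pi; rewrite !inE; apply/AP/orP => [[x [y [-> H]]]|[]/eqP->].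
    + case: (leqP y x) => [/block_swap_eq1 ->|xy]; first by left.
      right; apply/eqP; congr block_swap; apply/val_inj => /=; lia.
    + by exists ord0, ord0; rewrite block_swap_eq1.
    + by exists ord0, o1.
  rewrite cards2; case: eqP => // /permP/(_ ord0)/(congr1 val) /=.
  by rewrite block_swapE perm1.
(* Among the pairs with [x < y], the condition [1 < y] excludes only [(ord0, o1)]. *)
- have -> : A = (fun p => block_swap p.1 p.2) @:
                  ([set p : 'I_n.+1 * 'I_n.+1 | p.1 < p.2] :\ (ord0, o1)).
    apply/setP => pi; apply/AP/imsetP => [[x [y [-> H]]]|[[x y]]].
      exists (x, y) => //; rewrite !inE -pair_eqE /= -!val_eqE /=; lia.
    rewrite !inE -pair_eqE /= -!val_eqE /= => H ->.
    by exists x, y; split=> //; lia.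
  rewrite card_in_imset => [|[x y] [x' y']]; last first.
    by rewrite !inE /= => /andP[_ xy] /andP[_ xy'] /block_swap_inj2 ->.
  have := cardsD1 (ord0, o1) [set p : 'I_n.+1 * 'I_n.+1 | p.1 < p.2].
  by rewrite card_ltn_pairs !inE /= => ->; rewrite add1n subn1.
- apply/eqP; rewrite cards_eq0; apply/eqP/setP => pi; rewrite inE.
  by apply/AP => -[x [y [_ H]]]; lia.
Qed.
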